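(* Let $(V,E)$ be an unrooted directed tree and $\mu=(\mu_v)_{v\in V}$ a weight on $V$. Let $X=\ell^p(V,\mu)$, $1\leq p<+\infty$, or $X=c_0(V,\mu)$, and suppose that the backward shift $B$ is a bounded operator on $X$. Then $B$ is hypercyclic if and only if $B$ is recurrent.
   Context: $\mathbb{N}_0=\{0,1,2,\ldots\}$, $\mathbb{K}$ is $\mathbb{R}$ or $\mathbb{C}$. Directed tree: a pair $(V,E)$ with $V$ a non-empty countable set (vertices) and $E\subset\{(u,v):u,v\in V,u\neq v\}$ (edges) such that: (i) any two distinct vertices are joined by an undirected path; (ii) there is no circuit, i.e. no sequence $v_1,\ldots,v_n$ of distinct vertices, $n\geq2$, with $(v_j,v_{j+1})\in E$ for $1\le j<n$ and $(v_n,v_1)\in E$; (iii) for each $v\in V$ there is at most one $u\in V$ with $(u,v)\in E$; if it exists it is called the parent of $v$, denoted $\mathrm{par}(v)$. A root is a vertex without parent; the tree is unrooted if it has no root. $\mathrm{Chi}(v)=\{u\in V:\mathrm{par}(u)=v\}$. Weight on $V$: a family $\mu=(\mu_v)_{v\in V}$ of non-zero numbers in $\mathbb{K}$. $\ell^p(V,\mu)=\{f\in\mathbb{K}^V:\|f\|_{p,\mu}^p=\sum_{v}|f(v)\mu_v|^p<+\infty\}$ with norm $\|\cdot\|_{p,\mu}$; $c_0(V,\mu)$ is the set of $f\in\mathbb{K}^V$ such that for every $\varepsilon>0$ there is a finite $F\subset V$ with $|f(v)\mu_v|<\varepsilon$ for all $v\in V\setminus F$, with norm $\sup_v|f(v)\mu_v|$.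 The backward shift is $(Bf)(v)=\sum_{u\in\mathrm{Chi}(v)}f(u)$, an empty sum being $0$. A bounded operator $T$ on $X$ is hypercyclic if there is $x\in X$ such that $\{T^nx:n\in\mathbb{N}_0\}$ is dense in $X$. A vector $x$ is recurrent for $T$ if there is a strictly increasing sequence of integers $(n_k)_k$ in $\mathbb{N}_0$ with $T^{n_k}x\to x$; $T$ is recurrent if its set of recurrent vectors is dense in $X$. *)

(* Defs.v *)
From HB Require Import structures.
From mathcomp Require Import all_boot all_order all_algebra.
From mathcomp Require Import all_classical all_reals all_analysis.
From mathcomp Require Import showcase.summability.
From mathcomp Require Import complex.

Set Implicit Arguments.
Unset Strict Implicit.
Unset Printing Implicit Defensive.

Import Order.TTheory GRing.Theory Num.Theory numFieldNormedType.Exports.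
Local Open Scope classical_set_scope.
Local Open Scope ring_scope.

(* [E u v] means that (u, v) is an edge, i.e. that u is the parent of v. *)
Record directed_tree (V : countType) (E : rel V) : Prop := DirectedTree {
  tree_nonempty : inhabited V ;
  tree_irreflexive : irreflexive E ;
  tree_connected : forall u v : V, u != v ->
    exists s : seq V, path (fun x y => E x y || E y x) u s /\ last u s = v ;
  tree_acyclic : forall s : seq V, (2 <= size s)%N -> uniq s -> ~~ cycle E s ;
  tree_parent_unique : forall u u' v : V, E u v -> E u' v -> u = u' }.

Definition is_root (V : countType) (E : rel V) (v : V) : Prop :=
  ~ exists u, E u v.

Definition unrooted (V : countType) (E : rel V) : Prop :=
  forall v, ~ is_root E v.

Definition Chi (V : countType) (E : rel V) (v : V) : set V := [set u | E v u].

(* [scalar_field K modulus] says that K is the field of real numbers or the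
   field of complex numbers, with its R-valued modulus. In MathComp, the norm
   `|_| of R[i] takes values in R[i], hence the use of [normc]. *)
Inductive scalar_field (R : realType) :
    forall K : numFieldType, (K -> R) -> Prop :=
| real_scalars : @scalar_field R R (fun x : R => `|x|)
| complex_scalars :
    @scalar_field R R[i] (fun z : R[i] => ComplexField.Normc.normc z).

Record normed_fspace (V : countType) (K : numFieldType) (R : realType) :=
  NormedFspace { carrier : set (V -> K) ; fnorm : (V -> K) -> R }.

Section WeightedSpaces.
Variables (V : countType) (R : realType) (K : numFieldType) (modulus : K -> R).
Variable mu : V -> K.

Definition weight : Prop := forall v, mu v != 0.

Definition ellp_sum (p : R) (f : V -> K) : \bar R :=
  (\esum_(v in [set: V]) ((modulus (f v * mu v)) `^ p)%:E)%E.

Definition ellp (p : R) : normed_fspace V K R :=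
  {| carrier := [set f | (ellp_sum p f < +oo)%E] ;
     fnorm := fun f => fine (ellp_sum p f) `^ p^-1 |}.

Definition c0 : normed_fspace V K R :=
  {| carrier := [set f | forall eps : R, 0 < eps ->
       exists F : set V, finite_set F /\
         forall v, ~ F v -> modulus (f v * mu v) < eps] ;
     fnorm := fun f => sup [set modulus (f v * mu v) | v in [set: V]] |}.

End WeightedSpaces.

(* Vertices may have infinitely many children: the sum over Chi(v) is the
   unordered sum, i.e. the limit of the finite partial sums of f * 1_Chi(v)
   along the directed set of finite subsets of V. The value of [lim] is
   arbitrary when there is no limit; see [backward_shift_defined]. *)
Definition backward_shift (V : countType) (K : numFieldType) (E : rel V)
    (f : V -> K) : V -> K :=
  fun v => sum (K := K) (R := K^o) (f \_ (Chi E v)).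

Definition backward_shift_defined (V : countType) (K : numFieldType)
    (R : realType) (E : rel V) (X : normed_fspace V K R) : Prop :=
  forall f, carrier X f -> forall v,
    cvg (partial_sum (f \_ (Chi E v) : V -> K^o) @ totally).

Section Dynamics.
Variables (V : countType) (K : numFieldType) (R : realType).
Variables (X : normed_fspace V K R) (T : (V -> K) -> V -> K).

Definition bounded_operator : Prop :=
  [/\ forall f, carrier X f -> carrier X (T f),
      forall (a : K) (f g : V -> K), carrier X f -> carrier X g ->
        T (fun v => a * f v + g v) = (fun v => a * T f v + T g v) &
      exists C : R, forall f, carrier X f -> fnorm X (T f) <= C * fnorm X f].

Definition dense_in (A : set (V -> K)) : Prop :=
  A `<=` carrier X /\ forall f, carrier X f -> forall eps : R, 0 < eps ->
    exists g, A g /\ fnorm X (g \- f) < eps.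

Definition hypercyclic : Prop :=
  exists f, carrier X f /\ dense_in [set iter n T f | n in [set: nat]].

Definition recurrent_vector (f : V -> K) : Prop :=
  carrier X f /\ exists n_ : nat -> nat, {homo n_ : i j / (i < j)%N} /\
    fnorm X (iter (n_ k) T f \- f) @[k --> \oo] --> (0 : R).

Definition recurrent : Prop := dense_in recurrent_vector.

End Dynamics.

(* Main.v *)
(* Let f be a recurrent vector close to the indicator of a finite set F of vertices, say
   with B^n f close to f and n so large that par^n maps no vertex of F into F.
   For v in F, the value (B^n f)(v), close to 1, is the sum of f over Chi^n(v),
   where f is small because Chi^n(v) misses F; normalizing f on Chi^n(v) gives
   a small h with B^n h = e_v. For w = par^n(u) with u in F, either
   |(B^n f)(w)| is bounded below, and then |mu_w| is small since w is not in F,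
   or the values of f on Chi^n(w) outside F compensate those on F, and again
   normalizing f there gives a small h with B^n h = e_w. In both cases e_u has a
   small perturbation off F with small image under B^n. Combining these vectors,
   any g supported in F has a small perturbation g + x, with x finitely
   supported off F, such that B^n (g + x) is close to a prescribed vector
   supported in F. Adding up such perturbations for a dense sequence of targets
   gives a hypercyclic vector. Conversely, the orbit of a hypercyclic
   vector f returns near f at arbitrarily large times, because a finite part of
   the orbit cannot approximate every small multiple of a unit vector added to
   f; hence each point of this dense orbit is recurrent. *)
Require Import Defs.
From mathcomp Require Import all_boot all_order all_algebra.
From mathcomp Require Import all_classical all_reals all_analysis.
From mathcomp Require Import showcase.summability.
From mathcomp Require Import complex.
From mathcomp Require Import zify ring lra.

Set Implicit Arguments.
Unset Strict Implicit.
Unset Printing Implicit Defensive.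

Import Order.TTheory GRing.Theory Num.Theory numFieldNormedType.Exports.
Local Open Scope classical_set_scope.
Local Open Scope ring_scope.

(** * Absolute values on the scalar field *)

(** What the argument uses of the scalars, stated so that real and complex numbers are treated at
    once. Separability provides the coefficients of a countable dense set of targets. *)
Record absolute_value (R : realType) (K : numFieldType) (m : K -> R) : Prop :=
  AbsoluteValue {
    absv_ge0 : forall x, 0 <= m x ;
    absv_eq0 : forall x, m x = 0 -> x = 0 ;
    absvM : {morph m : x y / x * y} ;
    absvD : forall x y, m (x + y) <= m x + m y ;
    absv_nat : forall n, m n%:R = n%:R ;
    absv_separable : exists (Q : countType) (iota : Q -> K),
      forall z eps, 0 < eps -> exists q, m (iota q - z) < eps }.

Lemma real_absolute_value (R : realType) :
  absolute_value (fun x : R => `|x|).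
Proof.
split=> //.
- by move=> x /eqP; rewrite normr_eq0 => /eqP.
- exact: normrM.
- exact: ler_normD.
- exact: normr_nat.
exists rat, ratr => z eps e0.
have /rat_in_itvoo[q] : z < z + eps by lra.
rewrite in_itv/= => /andP[h1 h2]; exists q.
by rewrite gtr0_norm; lra.
Qed.

Lemma complex_absolute_value (R : realType) :
  absolute_value (fun z : R[i] => ComplexField.Normc.normc z).
Proof.
have ri0 : forall x : R, ComplexField.Normc.normc (x%:C)%C = `|x|.
  by move=> x; rewrite /= expr0n/= addr0 sqrtr_sqr.
have ri1 : forall x : R, ComplexField.Normc.normc (0 +i* x)%C = `|x|.
  by move=> x; rewrite /= expr0n/= add0r sqrtr_sqr.
have normc_le : forall x y : R, ComplexField.Normc.normc (x +i* y)%C <= `|x| + `|y|.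
  move=> x y; have -> : (x +i* y = x%:C + (0 +i* y))%C.
    by apply/eqP; rewrite eq_complex/= addr0 add0r !eqxx.
  by apply: le_trans (le_normcD _ _) _; rewrite ri0 ri1.
split.
- by case=> a b; exact: sqrtr_ge0.
- exact: ComplexField.Normc.eq0_normc.
- exact: ComplexField.Normc.normcM.
- exact: le_normcD.
- by move=> n; rewrite -[n%:R in LHS](rmorph_nat (real_complex R)) ri0 normr_nat.
exists (rat * rat)%type, (fun q => (ratr q.1 +i* ratr q.2)%C) => -[a b] eps e0.
have /rat_in_itvoo[q1] : a < a + eps / 2 by lra.
rewrite in_itv/= => /andP[h1 h2].
have /rat_in_itvoo[q2] : b < b + eps / 2 by lra.
rewrite in_itv/= => /andP[h3 h4].
exists (q1, q2).
apply: le_lt_trans (normc_le _ _) _.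
by rewrite !gtr0_norm; lra.
Qed.

Lemma scalar_field_absolute_value (R : realType) (K : numFieldType)
  (m : K -> R) : scalar_field m -> absolute_value m.
Proof.
by case; [exact: real_absolute_value | exact: complex_absolute_value].
Qed.

Section Modulus.
Variables (R : realType) (K : numFieldType) (m : K -> R).
Hypothesis Hm : absolute_value m.

Lemma absv0 : m 0 = 0.
Proof. by have := absv_nat Hm 0. Qed.

Lemma absv1 : m 1 = 1.
Proof. by have := absv_nat Hm 1. Qed.

Lemma absvN x : m (- x) = m x.
Proof.
have m1 : m (-1) = 1.
  have : m (-1) ^+ 2 = 1 by rewrite expr2 -absvM// mulrNN mulr1 absv1.
  by move/eqP; rewrite sqrf_eq1 => /orP[/eqP//|/eqP h]; have := absv_ge0 Hm (-1); rewrite h; lra.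
by rewrite -mulN1r absvM// m1 mul1r.
Qed.

Lemma absvB_ge x y : m x - m y <= m (x - y).
Proof. by have := absvD Hm (x - y) y; rewrite subrK; lra. Qed.

Lemma absvV x : x != 0 -> m x^-1 = (m x)^-1.
Proof.
move=> x0; have mx0 : m x != 0 by apply: contra x0 => /eqP /(absv_eq0 Hm) ->.
by apply: (mulfI mx0); rewrite -absvM// !divff// absv1.
Qed.

Lemma absv_gt0 x : x != 0 -> 0 < m x.
Proof.
move=> x0; rewrite lt_neqAle absv_ge0// andbT eq_sym.
by apply: contra x0 => /eqP /(absv_eq0 Hm) ->.
Qed.

Lemma absv_sum (I : Type) (s : seq I) (P : pred I) (F : I -> K) :
  m (\sum_(i <- s | P i) F i) <= \sum_(i <- s | P i) m (F i).
Proof.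
elim/big_ind2 : _ => //; first by rewrite absv0.
move=> x1 x2 y1 y2 h1 h2; apply: le_trans (absvD Hm _ _) _; lra.
Qed.

End Modulus.

(** * Ancestors in an unrooted tree *)

Section Tree.
Variables (V : countType) (E : rel V).
Hypotheses (Htree : directed_tree E) (Hun : unrooted E).

Lemma parent_exists : exists par : V -> V, forall u v, E u v = (u == par v).
Proof.
have /choice[par parP] : forall v, exists u, E u v.
  by move=> v; have := @Hun v; rewrite /is_root => /contrapT.
exists par => u v; apply/idP/eqP => [Euv|->]; last exact: parP.
exact: (tree_parent_unique Htree Euv (parP v)).
Qed.

Variable par : V -> V.
Hypothesis parE : forall u v, E u v = (u == par v).

(** A least period would give a circuit: the iterates of [u] are then distinct and, in reverse
    order, each is the parent of the next. Period one is excluded by irreflexivity. *)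
Lemma iter_par_aperiodic (u : V) (n : nat) : iter n.+1 par u != u.
Proof.
apply/negP => /eqP ex.
have exk : exists k, (0 < k)%N && (iter k par u == u).
  by exists n.+1; rewrite ex eqxx.
case: (ex_minnP exk) => k /andP[k0 /eqP uk] kmin.
(* Applying [par] to a repetition of the i-th iterate would give the smaller period i + 1. *)
have us : uniq (traject par u k).
  case: k k0 uk kmin => // k _ uk kmin; rewrite looping_uniq.
  apply/negP => /trajectP[i ik eqi].
  have : (0 < i.+1)%N && (iter i.+1 par u == u).
    by rewrite /= -eqi -iterS uk eqxx.
  by move=> /kmin; rewrite ltnS leqNgt ik.
case: k k0 uk kmin us => // k _ uk kmin us.
have cyc : cycle E (rev (traject par u k.+1)).
  rewrite rev_cycle /=.
  have -> : path (fun x y => E y x) u (rcons (traject par (par u) k) u) =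
            fpath par u (rcons (traject par (par u) k) u).
    by apply: eq_path => x y /=; rewrite parE eq_sym.
  by rewrite -[X in rcons _ X]uk iterSr -trajectSr fpath_traject.
have [k0|k0] := leqP 2 k.+1.
  have := tree_acyclic Htree (s := rev (traject par u k.+1)).
  by rewrite size_rev size_traject rev_uniq cyc us => /(_ k0 isT).
move: k0 uk; rewrite ltnS ltnS leqn0 => /eqP -> /= uk.
by have := tree_irreflexive Htree u; rewrite parE uk eqxx.
Qed.

(** By aperiodicity, each pair [u], [v] has at most one n with [iter n par u = v]; the bound is a
    maximum over the finitely many pairs. *)
Lemma iter_par_escapes (s : seq V) : exists N, forall n, (N <= n)%N ->
  forall u v, u \in s -> v \in s -> iter n par u != v.
Proof.
have H1 (u v : V) : exists N, forall n, (N <= n)%N -> iter n par u != v.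
  have [[n0 e0]|H] := pselect (exists n, iter n par u = v).
    exists n0.+1 => n n0n; rewrite -(subnK n0n) addnS -addSn iterD e0.
    exact: iter_par_aperiodic.
  by exists 0%N => n _; apply/eqP => e; apply: H; exists n.
have /choice[N HN] : forall p : V * V, exists N, forall n, (N <= n)%N -> iter n par p.1 != p.2.
  by case.
exists (\max_(p <- [seq (u, v) | u <- s, v <- s]) N p) => n Nn u v us vs.
apply: (HN (u, v)); apply: leq_trans Nn.
by apply: leq_bigmax_seq => //; apply/allpairsP; exists (u, v).
Qed.

End Tree.

(** Serves for the weights on a finite set of vertices and for the gaps along a finite part of an
    orbit. *)
Lemma seq_lower_bound (R : realType) (T : eqType) (s : seq T) (phi : T -> R) :
  (forall x, x \in s -> 0 < phi x) ->
  exists2 c : R, 0 < c & forall x, x \in s -> c <= phi x.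
Proof.
elim: s => [_|x s IH H]; first by exists 1.
have [|c c0 Hc] := IH; first by move=> y ys; apply: H; rewrite inE ys orbT.
exists (Num.min c (phi x)).
  by rewrite lt_min c0 H// mem_head.
move=> y; rewrite inE => /orP[/eqP ->|/Hc h]; first by rewrite ge_min lexx orbT.
by rewrite ge_min h.
Qed.

(** * Solid spaces of functions on the vertices *)

Definition delta (V : countType) (K : numFieldType) (u : V) : V -> K :=
  fun v => (v == u)%:R.

Definition supported (V : countType) (K : numFieldType) (s : seq V)
  (f : V -> K) : Prop := forall v, v \notin s -> f v = 0.

(* The last field stands in for completeness: it only concerns sequences that
   are stationary at every vertex, so that K need not be complete. *)
Record solid_fspace (V : countType) (R : realType) (K : numFieldType)
  (m : K -> R) (mu : V -> K) (X : normed_fspace V K R) : Prop := SolidFspace {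
  solid_add : forall f g, carrier X f -> carrier X g ->
    carrier X (f \+ g) /\ fnorm X (f \+ g) <= fnorm X f + fnorm X g ;
  solid_scale : forall a f, carrier X f ->
    carrier X (fun v => a * f v) /\
    fnorm X (fun v => a * f v) <= m a * fnorm X f ;
  solid_dom : forall f g, carrier X f -> (forall v, m (g v) <= m (f v)) ->
    carrier X g /\ fnorm X g <= fnorm X f ;
  solid_coord : forall f v, carrier X f -> m (f v) * m (mu v) <= fnorm X f ;
  solid_delta : forall u, carrier X (delta K u) /\
    fnorm X (delta K u) <= m (mu u) ;
  solid_tail : forall f eps, carrier X f -> 0 < eps -> exists s : seq V,
    fnorm X (fun v => if v \in s then 0 else f v) < eps ;
  solid_stationary : forall (s_ : nat -> V -> K) (e : nat -> R) (f : V -> K),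
    (forall i, carrier X (s_ i)) ->
    (forall i j, (j <= i)%N -> fnorm X (s_ i \- s_ j) <= e j) ->
    (forall eps, 0 < eps -> exists j, e j < eps) ->
    (forall v, exists i0, forall i, (i0 <= i)%N -> s_ i v = f v) ->
    carrier X f /\ forall j, fnorm X (f \- s_ j) <= e j }.

Section SolidTheory.
Variables (V : countType) (R : realType) (K : numFieldType) (m : K -> R).
Hypothesis Hm : absolute_value m.
Variables (mu : V -> K) (X : normed_fspace V K R).
Hypotheses (HX : solid_fspace m mu X) (Hmu : weight mu) (V0 : inhabited V).
Implicit Types (f g h : V -> K) (s t : seq V).

Lemma fnorm_ge0 f : carrier X f -> 0 <= fnorm X f.
Proof.
case: V0 => v Xf; apply: le_trans (solid_coord HX v Xf).
by rewrite mulr_ge0// absv_ge0.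
Qed.

Lemma carrier_zero : carrier X (fun=> 0).
Proof.
case: V0 => v; have [] // := solid_dom HX (g := fun=> 0) (proj1 (solid_delta HX v)).
by move=> w; rewrite (absv0 Hm) absv_ge0.
Qed.

Lemma fnorm_zero : fnorm X (fun=> 0) = 0.
Proof.
apply/eqP; rewrite eq_le fnorm_ge0 ?andbT; last exact: carrier_zero.
have [_ h] := solid_scale HX 0 carrier_zero.
have e : (fun=> 0) = (fun v : V => 0 * (fun=> 0 : K) v).
  by apply/funext => v; rewrite mul0r.
by rewrite [X in fnorm _ X]e; apply: le_trans h _; rewrite (absv0 Hm) mul0r.
Qed.

Lemma carrier_opp f : carrier X f -> carrier X (\- f).
Proof.
by move=> Xf; have [] // := solid_dom HX (g := \- f) Xf _ => v; rewrite absvN.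
Qed.

Lemma fnorm_opp f : carrier X f -> fnorm X (\- f) = fnorm X f.
Proof.
move=> Xf; apply/eqP; rewrite eq_le; apply/andP; split.
  by have [] // := solid_dom HX (g := \- f) Xf _ => v; rewrite absvN.
have [] // := solid_dom HX (g := f) (carrier_opp Xf) _ => v.
by rewrite absvN.
Qed.

Lemma carrier_sub f g : carrier X f -> carrier X g -> carrier X (f \- g).
Proof.
by move=> Xf Xg; have [] := solid_add HX Xf (carrier_opp Xg).
Qed.

Lemma ler_fnormB f g : carrier X f -> carrier X g ->
  fnorm X (f \- g) <= fnorm X f + fnorm X g.
Proof.
move=> Xf Xg; rewrite -(fnorm_opp Xg).
by have [] := solid_add HX Xf (carrier_opp Xg).
Qed.

Lemma fnorm_dist_triangle f g h : carrier X f -> carrier X g -> carrier X h ->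
  fnorm X (f \- h) <= fnorm X (f \- g) + fnorm X (g \- h).
Proof.
move=> Xf Xg Xh.
have [_] := solid_add HX (carrier_sub Xf Xg) (carrier_sub Xg Xh).
apply: le_trans; rewrite le_eqVlt; apply/orP; left; apply/eqP.
by congr fnorm; apply/funext => v /=; rewrite addrA subrK.
Qed.

Lemma solid_sum (I : eqType) (r : seq I) (c : I -> K) (g : I -> V -> K) :
  (forall i, i \in r -> carrier X (g i)) ->
  carrier X (fun v => \sum_(i <- r) c i * g i v) /\
  fnorm X (fun v => \sum_(i <- r) c i * g i v) <=
    \sum_(i <- r) m (c i) * fnorm X (g i).
Proof.
elim: r => [_|i r IH Xg].
  have -> : (fun v => \sum_(i <- [::]) c i * g i v) = (fun=> 0).
    by apply/funext => v; rewrite big_nil.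
  by rewrite big_nil fnorm_zero; split => //; exact: carrier_zero.
have [|h1 h2] := IH; first by move=> j jr; apply: Xg; rewrite inE jr orbT.
have Xi : carrier X (g i) by apply: Xg; rewrite mem_head.
have [h3 h4] := solid_scale HX (c i) Xi.
have -> : (fun v => \sum_(j <- i :: r) c j * g j v) =
    (fun v => c i * g i v) \+ (fun v => \sum_(j <- r) c j * g j v).
  by apply/funext => v; rewrite big_cons.
rewrite big_cons; have [h5 h6] := solid_add HX h3 h1; split=> //.
by apply: le_trans h6 _; rewrite lerD.
Qed.

Lemma supported_sum s f : uniq s -> supported s f ->
  f = fun v => \sum_(u <- s) f u * delta K u v.
Proof.
move=> us sf; apply/funext => v; case: (boolP (v \in s)) => vs; last first.
  rewrite sf// big1_seq// => u /andP[_ us'].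
  rewrite /delta; case: eqP vs => [->|]; first by rewrite us'.
  by rewrite mulr0.
rewrite (bigD1_seq v)//= /delta eqxx mulr1 big1 ?addr0// => u uv.
by rewrite eq_sym (negbTE uv) mulr0.
Qed.

Lemma supported_undup s f : supported s f -> supported (undup s) f.
Proof. by move=> sf v; rewrite mem_undup; exact: sf. Qed.

Lemma supported_carrier s f : supported s f -> carrier X f.
Proof.
move=> /supported_undup sf; rewrite (supported_sum (undup_uniq s) sf).
have [] // := solid_sum (r := undup s) f (g := fun u => delta K u).
by move=> u _; have [] := solid_delta HX u.
Qed.

(** * Iterates of an operator that moves unit vectors along [par] *)

Section Operator.
Variables (T : (V -> K) -> V -> K) (par : V -> V).
Hypotheses (HT : bounded_operator X T)
  (Tdelta : forall u, T (delta K u) = delta K (par u)).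

Lemma carrier_iter n f : carrier X f -> carrier X (iter n T f).
Proof. by case: HT => Tc _ _ Xf; elim: n => //= n; exact: Tc. Qed.

Lemma operator_zero : T (fun=> 0) = (fun=> 0).
Proof.
case: HT => _ Tl _; have X0 := carrier_zero.
have := Tl (-1) _ _ X0 X0.
have -> : (fun v : V => -1 * (fun=> 0) v + (fun=> 0) v) = (fun=> 0 : K).
  by apply/funext => v; rewrite mulr0 addr0.
by move=> ->; apply/funext => v; rewrite mulN1r addNr.
Qed.

Lemma iter_zero n : iter n T (fun=> 0) = (fun=> 0).
Proof. by elim: n => //= n ->; exact: operator_zero. Qed.

Lemma iter_linear n a f g : carrier X f -> carrier X g ->
  iter n T (fun v => a * f v + g v) =
  (fun v => a * iter n T f v + iter n T g v).
Proof.
case: HT => _ Tl _ Xf Xg; elim: n => //= n ->.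
by apply: Tl; exact: carrier_iter.
Qed.

Lemma iter_sub n f g : carrier X f -> carrier X g ->
  iter n T (f \- g) = iter n T f \- iter n T g.
Proof.
move=> Xf Xg; have := iter_linear n (-1) Xg Xf.
have -> : (fun v => -1 * g v + f v) = f \- g.
  by apply/funext => v /=; rewrite mulN1r addrC.
by move=> ->; apply/funext => v /=; rewrite mulN1r addrC.
Qed.

Lemma iter_sum n (I : eqType) (r : seq I) (c : I -> K) (g : I -> V -> K) :
  (forall i, i \in r -> carrier X (g i)) ->
  iter n T (fun v => \sum_(i <- r) c i * g i v) =
  (fun v => \sum_(i <- r) c i * iter n T (g i) v).
Proof.
elim: r => [_|i r IH Xg].
  transitivity (fun _ : V => 0 : K); last by apply/funext => v; rewrite big_nil.
  by rewrite -[RHS](iter_zero n); congr iter; apply/funext => v; rewrite big_nil.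
have Xr j : j \in r -> carrier X (g j) by move=> jr; apply: Xg; rewrite inE jr orbT.
have -> : (fun v => \sum_(j <- i :: r) c j * g j v) =
    (fun v => c i * g i v + (fun v => \sum_(j <- r) c j * g j v) v).
  by apply/funext => v; rewrite big_cons.
rewrite iter_linear ?IH//; last 2 first.
- by apply: Xg; rewrite mem_head.
- by have [] := solid_sum c Xr.
by apply/funext => v; rewrite big_cons.
Qed.

Lemma iter_delta n u : iter n T (delta K u) = delta K (iter n par u).
Proof. by elim: n => //= n ->; rewrite Tdelta. Qed.

(** A finitely supported function is a finite combination of unit vectors, so its iterates involve
    finite sums only. *)
Lemma iter_supported n s f : uniq s -> supported s f ->
  iter n T f = fun w => \sum_(u <- s | iter n par u == w) f u.
Proof.
move=> us sf; rewrite {1}(supported_sum us sf) iter_sum; last first.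
  by move=> u _; have [] := solid_delta HX u.
apply/funext => w; rewrite [RHS]big_mkcond/=; apply: eq_bigr => u _.
by rewrite iter_delta /delta eq_sym; case: eqP; rewrite ?mulr1 ?mulr0.
Qed.

(** The constant is raised to at least 1 so that its powers are at least 1 and can be divided by. *)
Lemma iter_bounded : exists2 D : R, 1 <= D & forall n f, carrier X f ->
  fnorm X (iter n T f) <= D ^+ n * fnorm X f.
Proof.
case: HT => _ _ [C HC]; exists (Num.max 1 C); first by rewrite le_max lexx.
move=> n f Xf; elim: n => [|n IH]; first by rewrite expr0 mul1r.
rewrite iterS; apply: le_trans (HC _ (carrier_iter n Xf)) _.
rewrite exprS -mulrA.
apply: (@le_trans _ _ (Num.max 1 C * fnorm X (iter n T f))).
  by rewrite ler_wpM2r ?le_max ?lexx ?orbT// fnorm_ge0//; exact: carrier_iter.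
by rewrite ler_wpM2l// le_max ler01.
Qed.

(** * Recurrence and hypercyclicity *)

(** Trades the sequence of return times for single returns, arbitrarily late and precise.
    Conversely, such returns are chosen one after another, the k-th with error below 1/(k+1). *)
Lemma recurrent_vectorP f : recurrent_vector X T f <-> carrier X f /\
  forall N eps, 0 < eps ->
    exists2 n, (N <= n)%N & fnorm X (iter n T f \- f) < eps.
Proof.
split=> [[Xf [n_ [n_mono n_cvg]]]|[Xf H]]; split=> //.
  move=> N eps e0.
  have n_ge k : (k <= n_ k)%N.
    by elim: k => // k IH; apply: leq_ltn_trans IH _; exact: n_mono.
  have /cvgrPdist_lt/(_ eps e0)[M _ HM] := n_cvg.
  exists (n_ (maxn M N)).
    by apply: leq_trans (n_ge _); exact: leq_maxr.
  have /= := HM (maxn M N) (leq_maxl _ _).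
  by rewrite sub0r normrN; apply: le_lt_trans; exact: ler_norm.
have /choice[G HG] : forall p : nat * nat, exists n, (p.1 <= n)%N /\
    fnorm X (iter n T f \- f) < p.2.+1%:R^-1.
  by move=> [N k]; have [|n] := H N k.+1%:R^-1; [rewrite invr_gt0|exists n].
pose n_ := fix n_ k := if k is k'.+1 then G ((n_ k').+1, k) else G (0, 0)%N.
exists n_; split.
  by apply: homo_ltn; [exact: ltn_trans|move=> k; exact: (HG (_, k.+1)).1].
apply/cvgrPdist_lt => eps e0.
have := near_infty_natSinv_lt (PosNum e0); apply: filterS => k /= hk.
rewrite sub0r normrN ger0_norm; last first.
  by apply: fnorm_ge0; apply: carrier_sub => //; exact: carrier_iter.
apply: lt_trans hk.
by case: k => [|k]; [exact: (HG (0, 0)%N).2|exact: (HG (_, k.+1)).2].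
Qed.

Hypothesis par_escapes : forall s : seq V, exists N, forall n, (N <= n)%N ->
  forall u v, u \in s -> v \in s -> iter n par u != v.

(** * Small perturbations obtained from one return of a finitely supported vector *)

Section Splitting.
Variables (s t : seq V) (c d eta : R) (n : nat) (f : V -> K).
Hypotheses (ut : uniq t) (st : {subset s <= t}) (tf : supported t f).
Hypothesis escape : forall u v, u \in s -> v \in s -> iter n par u != v.
Hypotheses (mu_ge : forall v, v \in s -> c <= m (mu v)).
Hypotheses (eta0 : 0 < eta) (eta_d : 4 * eta <= d) (eta_c : 8 * eta <= c).
Let g : V -> K := fun v => (v \in s)%:R.
Hypothesis f_near : fnorm X (f \- g) <= eta.
Hypothesis Tf_near : fnorm X (iter n T f \- g) <= 2 * eta.

Let c0 : 0 < c. Proof. by move: eta0 eta_c; lra. Qed.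

Let Xf : carrier X f. Proof. exact: supported_carrier tf. Qed.

Let Xg : carrier X g.
Proof.
by apply: (supported_carrier (s := s)) => v vs; rewrite /g (negbTE vs).
Qed.

(** The part of [iter n T f w] that comes from vertices off [s]. *)
Let r w := \sum_(u <- t | (u \notin s) && (iter n par u == w)) f u.

(** The witness restricts [f] to the vertices off [s] that [iter n par] sends to [w], and divides by
    the sum [r w]. Off [s], [f] coincides with [f \- g], so by solidity the norm is at most
    [4 * eta <= d]. *)
Let small_preimage w : 4^-1 <= m (r w) -> exists h t', [/\ supported t' h,
  forall v, v \in s -> h v = 0, fnorm X h <= d & iter n T h = delta K w].
Proof.
move=> rw; pose hw v := if (v \notin s) && (iter n par v == w) then f v else 0.
have shw : supported t hw.
  by move=> v vt; rewrite /hw; case: ifP => // _; exact: tf.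
have Xhw : carrier X hw := supported_carrier shw.
have r0 : r w != 0 by apply/eqP => r0; move: rw; rewrite r0 (absv0 Hm); lra.
exists (fun v => (r w)^-1 * hw v), t; split.
- by move=> v vt; rewrite shw// mulr0.
- by move=> v vs; rewrite /hw vs mulr0.
- have [_] := solid_scale HX (r w)^-1 Xhw; move/le_trans; apply.
  have [_ h] : carrier X hw /\ fnorm X hw <= fnorm X (f \- g).
    apply: (solid_dom HX); first exact: carrier_sub.
    move=> v /=; rewrite /hw /g; case: (v \in s) => /=.
      by rewrite (absv0 Hm) (absv_ge0 Hm).
    by case: ifP => _; rewrite ?subr0// (absv0 Hm) (absv_ge0 Hm).
  have h1 : m (r w)^-1 <= 4.
    have rw0 : 0 < m (r w) by apply: lt_le_trans rw; rewrite invr_gt0.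
    by rewrite (absvV Hm)// invf_ple ?posrE.
  apply: le_trans (ler_pM (absv_ge0 Hm _) (fnorm_ge0 Xhw) h1 (le_trans h f_near)) _.
  by [].
have := iter_linear n (r w)^-1 Xhw carrier_zero; rewrite iter_zero.
have -> : (fun v => (r w)^-1 * hw v + (fun=> 0) v) = (fun v => (r w)^-1 * hw v).
  by apply/funext => v; rewrite addr0.
move=> ->; rewrite (iter_supported n ut shw); apply/funext => v; rewrite addr0.
have e : \sum_(u <- t | iter n par u == v) hw u =
    \sum_(u <- t | (u \notin s) && (iter n par u == v) && (v == w)) f u.
  rewrite big_mkcond [RHS]big_mkcond/=; apply: eq_bigr => u _; rewrite /hw.
  case: (iter n par u =P v) => [->|_]; last by rewrite andbF.
  by rewrite andbT.
rewrite e /delta; case: (v =P w) => [->|_].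
  by under eq_bigl do rewrite andbT; rewrite -/(r w) mulVf.
by under eq_bigl do rewrite andbF; rewrite big_pred0_eq mulr0.
Qed.

Let iter_value w : iter n T f w =
  r w + \sum_(u <- t | (u \in s) && (iter n par u == w)) f u.
Proof.
rewrite (iter_supported n ut tf) (bigID (mem s))/= addrC; congr (_ + _);
by apply: eq_bigl => u; rewrite andbC.
Qed.

Let f_near1 v : v \in s -> m (f v - 1) <= 4^-1.
Proof.
move=> vs; have := solid_coord HX v (carrier_sub Xf Xg).
rewrite /= /g vs => /le_trans/(_ f_near) h.
have h1 : m (f v - 1) * c <= eta.
  by apply: le_trans h; rewrite ler_wpM2l ?mu_ge// (absv_ge0 Hm).
move: c0 eta0 eta_c h1; nra.
Qed.

(** No vertex of [s] is sent to [u], so [r u] is the whole value of [iter n T f] at [u], which is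
    within 1/4 of 1. *)
Lemma splitting_preimage u : u \in s -> exists h t', [/\ supported t' h,
  forall v, v \in s -> h v = 0, fnorm X h <= d & iter n T h = delta K u].
Proof.
move=> us; apply: small_preimage.
have := solid_coord HX u (carrier_sub (carrier_iter n Xf) Xg).
rewrite /= /g us iter_value big1_seq ?addr0; last first.
  by move=> v /andP[/andP[vs /eqP e]]; have := escape vs us; rewrite e eqxx.
move=> /le_trans/(_ Tf_near) h.
have h1 : m (r u - 1) * c <= 2 * eta.
  by apply: le_trans h; rewrite ler_wpM2l ?mu_ge// (absv_ge0 Hm).
have h2 : m (r u - 1) <= 4^-1 by move: c0 eta0 eta_c h1; nra.
have := absvB_ge Hm 1 (1 - r u).
by rewrite subKr (absv1 Hm) -(absvN Hm (1 - r u)) opprB; lra.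
Qed.

(** If [r w] is not small, a small preimage of the unit vector at [w] cancels the image of
    [delta K u] exactly. Otherwise the weight at [w] is small and [h = 0] suffices. *)
Lemma splitting_kernel u : u \in s -> exists h t', [/\ supported t' h,
  forall v, v \in s -> h v = 0, fnorm X h <= d &
  fnorm X (iter n T (delta K u \- h)) <= d].
Proof.
move=> us; set w := iter n par u.
have Xu : carrier X (delta K u) by have [] := solid_delta HX u.
have [rw|rw] := lerP 4^-1 (m (r w)).
  have [h [t' [sh offs hd Th]]] := small_preimage rw; exists h, t'; split=> //.
  have -> : iter n T (delta K u \- h) = (fun=> 0).
    rewrite iter_sub//; last exact: supported_carrier sh.
    by rewrite Th iter_delta -/w; apply/funext => v /=; rewrite subrr.
  by rewrite fnorm_zero; move: eta0 eta_d; lra.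
exists (fun=> 0), [::]; split=> //; first by rewrite fnorm_zero; move: eta0 eta_d; lra.
have -> : delta K u \- (fun=> 0) = delta K u.
  by apply/funext => v /=; rewrite subr0.
rewrite iter_delta -/w; have [_ /le_trans] := solid_delta HX w; apply.
have ws : w \notin s.
  by apply/negP => ws; have := escape us ws; rewrite eqxx.
have := solid_coord HX w (carrier_sub (carrier_iter n Xf) Xg).
rewrite /= /g (negbTE ws) subr0 => /le_trans/(_ Tf_near) h.
(* As [w] is off [s], [h] bounds [m (iter n T f w) * m (mu w)] by [2 * eta]; a first factor at least
   1/2 makes the weight at most [4 * eta <= d]. *)
suff h1 : 2^-1 <= m (iter n T f w).
  by have := absv_ge0 Hm (mu w); move: eta0 eta_d h h1; nra.
pose P v := (v \in s) && (iter n par v == w).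
pose q := \sum_(v <- t | P v) f v.
rewrite iter_value -[X in r w + X]/q.
(* [k] counts the vertices of [s] sent to [w], among them [u]. On each, [f] is within 1/4 of 1, so
   [q] has modulus at least 3/4, and [r w] can cancel less than 1/4 of it. *)
pose k : R := \sum_(v <- t | P v) 1.
have k1 : 1 <= k.
  rewrite /k big_mkcond (bigD1_seq u) ?st//= {1}/P us eqxx lerDl sumr_ge0//.
  by move=> v _; case: ifP.
have qk : m (q - \sum_(v <- t | P v) 1) <= k * 4^-1.
  rewrite /q -sumrB /k mulr_suml; apply: le_trans (absv_sum Hm _ _ _) _.
  by apply: ler_sum => v /andP[vs _]; rewrite mul1r; exact: f_near1.
have mk : m (\sum_(v <- t | P v) 1) = k.
  rewrite /k -[in LHS](natr_sum K _ _ (fun=> 1%N)) (absv_nat Hm).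
  by rewrite natr_sum.
have h1 : k - m q <= m (q - \sum_(v <- t | P v) 1).
  by rewrite -mk -(absvN Hm (q - _)) opprB; exact: absvB_ge.
have h2 : m q - m (r w) <= m (r w + q).
  by rewrite [r w + q]addrC -(absvN Hm (r w)) -[X in _ <= m (_ + X)]opprK; exact: absvB_ge.
lra.
Qed.

End Splitting.

(** A recurrent vector close to the indicator of [s] is truncated to a finitely supported one, to
    which the two splitting lemmas apply. *)
Lemma recurrent_splitting s d : recurrent X T -> 0 < d ->
  exists n, forall u, u \in s ->
    (exists h t, [/\ supported t h, forall v, v \in s -> h v = 0,
      fnorm X h <= d & iter n T h = delta K u]) /\
    (exists h t, [/\ supported t h, forall v, v \in s -> h v = 0,
      fnorm X h <= d & fnorm X (iter n T (delta K u \- h)) <= d]).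
Proof.
move=> [_ rec] d0.
have [c c0 Hc] := seq_lower_bound (s := s) (phi := fun v => m (mu v))
  (fun v _ => absv_gt0 Hm (Hmu v)).
pose eta := Num.min (d / 4) (c / 8).
have [eta_d eta_c] : eta <= d / 4 /\ eta <= c / 8.
  by rewrite /eta !ge_min !lexx orbT.
have eta0 : 0 < eta by rewrite lt_min; apply/andP; split; lra.
pose g v : K := (v \in s)%:R.
have Xg : carrier X g.
  by apply: (supported_carrier (s := s)) => v vs; rewrite /g (negbTE vs).
have [|f [/recurrent_vectorP[Xf recf] fg]] := rec g Xg (eta / 2); first lra.
have [N HN] := par_escapes s.
have [|n Nn Tff] := recf N (eta / 2); first lra.
have [D D1 HD] := iter_bounded.
have Dn : 0 < D ^+ n by rewrite exprn_gt0//; lra.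
have Dn1 : 1 <= D ^+ n by rewrite exprn_ege1.
(* The truncation is chosen after [n]: its error must stay at most [eta / 4] once multiplied by the
   bound [D ^+ n] of the n-th iterate. *)
have [|t0 ht0] := solid_tail HX (eps := eta / 4 / D ^+ n) Xf.
  by rewrite divr_gt0//; lra.
pose t := undup (t0 ++ s); pose f' v := if v \in t then f v else 0.
have sf' : supported t f' by move=> v vt; rewrite /f' (negbTE vt).
have Xf' : carrier X f' := supported_carrier sf'.
pose f0 v := if v \in t0 then 0 else f v.
have Xf0 : carrier X f0.
  have [] // := solid_dom HX (g := f0) Xf _ => v.
  by rewrite /f0; case: ifP => _; rewrite ?(absv0 Hm) ?(absv_ge0 Hm).
have ff' : fnorm X (f' \- f) < eta / 4 / D ^+ n.
  apply: le_lt_trans ht0; have [] // := solid_dom HX (g := f' \- f) Xf0 _ => v.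
  rewrite /= /f' /f0 mem_undup mem_cat; case: (v \in t0) => /=; first by rewrite subrr.
  by case: (v \in s); rewrite ?subrr ?sub0r ?absvN// (absv0 Hm) (absv_ge0 Hm).
have Tff' : fnorm X (iter n T f' \- iter n T f) <= eta / 4.
  rewrite -iter_sub//; apply: le_trans (HD _ _ (carrier_sub Xf' Xf)) _.
  by rewrite mulrC -ler_pdivlMr//; exact: ltW.
have ff'' : fnorm X (f' \- f) <= eta / 4.
  by apply: le_trans (ltW ff') _; rewrite ler_pdivrMr//; nra.
have e1 : fnorm X (f' \- g) <= eta.
  by apply: le_trans (fnorm_dist_triangle Xf' Xf Xg) _; lra.
have e2 : fnorm X (iter n T f' \- g) <= 2 * eta.
  apply: le_trans (fnorm_dist_triangle (carrier_iter n Xf') (carrier_iter n Xf) Xg) _.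
  have := fnorm_dist_triangle (carrier_iter n Xf) Xf Xg; lra.
have st : {subset s <= t} by move=> v vs; rewrite mem_undup mem_cat vs orbT.
exists n => u us; split.
  by apply: (splitting_preimage (undup_uniq _) sf' (HN n Nn) Hc eta0 _ _ e1 e2 us); lra.
by apply: (splitting_kernel (undup_uniq _) st sf' (HN n Nn) Hc eta0 _ _ e1 e2 us); lra.
Qed.

(** * From recurrence to a hypercyclic vector *)

(** [x] has two terms: one, subtracted, makes the image of [f] small; the other combines small
    preimages of unit vectors and has image exactly [k]. *)
Lemma recurrent_transitive s f k eps : recurrent X T ->
  supported s f -> supported s k -> 0 < eps ->
  exists n x t, [/\ supported t x, forall v, v \in s -> x v = 0,
    fnorm X x <= eps & fnorm X (iter n T (f \+ x) \- k) <= eps].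
Proof.
move=> rec sf sk e0; pose S := \sum_(u <- undup s) (m (k u) + m (f u)).
have S0 : 0 <= S by apply: sumr_ge0 => u _; rewrite addr_ge0// (absv_ge0 Hm).
(* [S] is the total size of the coefficients of the vectors bounded by [d]; adding 1 keeps the
   divisor positive. *)
pose d := eps / (1 + S).
have d0 : 0 < d by rewrite divr_gt0//; lra.
have dS : S * d <= eps.
  rewrite /d mulrCA ger_pMr// ler_pdivrMr; lra.
have [n Hn] := recurrent_splitting s rec d0.
have /choice[h Hh] : forall u, exists h : (V -> K) * seq V,
    [/\ supported h.2 h.1, forall v, v \in s -> h.1 v = 0,
      fnorm X h.1 <= d & u \in s -> iter n T h.1 = delta K u].
  move=> u; case: (boolP (u \in s)) => us; last first.
    by exists (fun=> 0, [::]); split=> //=; rewrite fnorm_zero ltW.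
  by have [[h [t [? ? ? ?]]] _] := Hn u us; exists (h, t).
have /choice[h' Hh'] : forall u, exists h : (V -> K) * seq V,
    [/\ supported h.2 h.1, forall v, v \in s -> h.1 v = 0,
      fnorm X h.1 <= d &
      u \in s -> fnorm X (iter n T (delta K u \- h.1)) <= d].
  move=> u; case: (boolP (u \in s)) => us; last first.
    by exists (fun=> 0, [::]); split=> //=; rewrite fnorm_zero ltW.
  by have [_ [h0 [t [? ? ? ?]]]] := Hn u us; exists (h0, t).
have Xd u : carrier X (delta K u) by have [] := solid_delta HX u.
have Xh u : carrier X (h u).1 by have [su _ _ _] := Hh u; exact: supported_carrier su.
have Xh' u : carrier X (h' u).1 by have [su _ _ _] := Hh' u; exact: supported_carrier su.
pose r := undup s.
pose xk v := \sum_(u <- r) k u * (h u).1 v.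
pose xf v := \sum_(u <- r) f u * (h' u).1 v.
pose yf v := \sum_(u <- r) f u * (delta K u \- (h' u).1) v.
have [Xk Nk] := solid_sum (r := r) k (fun u _ => Xh u).
have [Xf Nf] := solid_sum (r := r) f (fun u _ => Xh' u).
have Xdh u : u \in r -> carrier X (delta K u \- (h' u).1).
  by move=> _; exact: carrier_sub.
have [Xyf _] := solid_sum f Xdh.
exists n, (xk \- xf), (flatten [seq (h u).2 ++ (h' u).2 | u <- r]); split.
- move=> v vt; have vu u : u \in r -> (v \notin (h u).2) && (v \notin (h' u).2).
    move=> ur; rewrite -negb_or -mem_cat; apply: contra vt => vt.
    by apply/flattenP; exists ((h u).2 ++ (h' u).2) => //; apply/mapP; exists u.
  rewrite /= /xk /xf !big1_seq ?subrr// => u /andP[_ /vu/andP[v1 v2]].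
    by have [su _ _ _] := Hh' u; rewrite su// mulr0.
  by have [su _ _ _] := Hh u; rewrite su// mulr0.
- move=> v vs; rewrite /= /xk /xf !big1_seq ?subrr// => u _.
    by have [_ su _ _] := Hh' u; rewrite su// mulr0.
  by have [_ su _ _] := Hh u; rewrite su// mulr0.
- apply: le_trans (ler_fnormB Xk Xf) _; apply: le_trans dS.
  rewrite /S big_split/= mulrDl !mulr_suml.
  apply: lerD; [apply: le_trans Nk _|apply: le_trans Nf _];
    apply: ler_sum => u _; rewrite ler_wpM2l ?(absv_ge0 Hm)//.
    by have [] := Hh u.
  by have [] := Hh' u.
have -> : f \+ (xk \- xf) = (fun v => 1 * yf v + xk v).
  apply/funext => v; rewrite /= mul1r {1}(supported_sum (undup_uniq s) (supported_undup sf)).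
  rewrite addrCA addrC -/r /yf; congr (_ + _); rewrite -sumrB.
  by apply: eq_bigr => u _; rewrite mulrBr.
rewrite iter_linear// /yf iter_sum// /xk iter_sum//.
have -> : (fun v => 1 * (\sum_(u <- r) f u * iter n T (delta K u \- (h' u).1) v) +
    \sum_(u <- r) k u * iter n T (h u).1 v) \- k =
    (fun v => \sum_(u <- r) f u * iter n T (delta K u \- (h' u).1) v).
  apply/funext => v; rewrite /= mul1r.
  rewrite {2}(supported_sum (undup_uniq s) (supported_undup sk)) -/r.
  rewrite -addrA [X in _ + X](_ : _ = 0) ?addr0//.
  apply/eqP; rewrite subr_eq0; apply/eqP; apply: eq_big_seq => u.
  by rewrite mem_undup => us; have [_ _ _ ->] := Hh u.
have [|_ /le_trans] := solid_sum (r := r) f (g := fun u => iter n T (delta K u \- (h' u).1)).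
  by move=> u ur; apply: carrier_iter; exact: Xdh.
apply; apply: le_trans dS; rewrite /S mulr_suml big_seq [leRHS]big_seq.
apply: ler_sum => u; rewrite mem_undup => us; have [_ _ _ /(_ us) hu] := Hh' u.
apply: ler_pM => //; first exact: (absv_ge0 Hm).
  by apply: fnorm_ge0; apply: carrier_iter; apply: Xdh; rewrite mem_undup.
by rewrite lerDr (absv_ge0 Hm).
Qed.

(* Each new block is supported off the previous ones, so that the partial sums
   are truncations of the hypercyclic vector. *)
Lemma recurrent_hypercyclic_targets (y_ : nat -> V -> K) (t_ : nat -> seq V)
    (d_ : nat -> R) : recurrent X T ->
  (forall j, supported (t_ j) (y_ j)) -> (forall j, 0 < d_ j) ->
  (forall y (eps : R), carrier X y -> 0 < eps ->
    exists j, d_ j < eps /\ fnorm X (y_ j \- y) < eps) ->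
  hypercyclic X T.
Proof.
move=> rec yt d0 ydense.
have [D D1 HD] := iter_bounded.
have Dn n : 0 < D ^+ n by rewrite exprn_gt0//; lra.
(* A state consists of a partial sum, a list containing its support, and a bound on all later
   changes in norm. The step also records the time at which the target is approached. *)
pose state := ((V -> K) * seq V * R)%type.
have /choice[G HG] : forall p : nat * state, exists q : state * nat,
    supported p.2.1.2 p.2.1.1 -> 0 < p.2.2 ->
    [/\ supported q.1.1.2 q.1.1.1, 0 < q.1.2,
      forall v, v \in p.2.1.2 -> v \in q.1.1.2 /\ q.1.1.1 v = p.2.1.1 v &
      [/\ fnorm X (q.1.1.1 \- p.2.1.1) <= p.2.2 / 2, q.1.2 <= p.2.2 / 2,
        D ^+ q.2 * q.1.2 <= d_ p.1 &
        fnorm X (iter q.2 T q.1.1.1 \- y_ p.1) <= d_ p.1]].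
  move=> [j [[f s] e]] /=.
  have [[sf e0]|H] := pselect (supported s f /\ 0 < e); last first.
    by exists ((f, s, e), 0%N) => sf e0; case: H.
  have sf' : supported (s ++ t_ j) f.
    by move=> v; rewrite mem_cat negb_or => /andP[vs _]; exact: sf.
  have sy' : supported (s ++ t_ j) (y_ j).
    by move=> v; rewrite mem_cat negb_or => /andP[_ vs]; exact: yt.
  have [|n [x [t [tx xs Nx NT]]]] :=
      recurrent_transitive (eps := Num.min (e / 2) (d_ j)) rec sf' sy'.
    by rewrite lt_min d0 andbT; lra.
  move: Nx NT; rewrite !le_min => /andP[Nx _] /andP[_ NT].
  (* Halving the bound makes the increments summable; the term [d_ j / D ^+ n] ensures that later
     increments move the n-th iterate by at most [d_ j]. *)
  exists ((f \+ x, s ++ t, Num.min (e / 2) (d_ j / D ^+ n)), n) => _ _ /=.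
  split.
  - move=> v; rewrite mem_cat negb_or => /andP[vs vt].
    by rewrite /= sf// tx// addr0.
  - by rewrite lt_min !divr_gt0.
  - by move=> v vs; rewrite /= mem_cat vs xs ?addr0// mem_cat vs.
  split=> //.
  - by have -> : (f \+ x) \- f = x; first by apply/funext => v /=; rewrite addrAC subrr add0r.
  - by rewrite ge_min lexx.
  by rewrite mulrC -ler_pdivlMr// ge_min lexx orbT.
pose st := fix st j : state :=
  if j is i.+1 then (G (i, st i)).1 else ((fun=> 0, [::]), 1).
pose s_ j := (st j).1.1; pose F_ j := (st j).1.2; pose e_ j := (st j).2.
pose n_ j := (G (j, st j)).2.
have inv j : supported (F_ j) (s_ j) /\ 0 < e_ j.
  elim: j => [|j [IH1 IH2]]; first by split; rewrite /e_/=.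
  by have [] := HG (j, st j) IH1 IH2.
have step j : [/\ forall v, v \in F_ j -> v \in F_ j.+1 /\ s_ j.+1 v = s_ j v,
    fnorm X (s_ j.+1 \- s_ j) <= e_ j / 2, e_ j.+1 <= e_ j / 2,
    D ^+ n_ j * e_ j.+1 <= d_ j &
    fnorm X (iter (n_ j) T (s_ j.+1) \- y_ j) <= d_ j].
  by have [_ _ ? [? ? ? ?]] := HG (j, st j) (inv j).1 (inv j).2.
have Xs j : carrier X (s_ j) := supported_carrier (inv j).1.
(* The increments telescope, since [e_ j / 2 <= e_ j - e_ j.+1]. *)
have dist i j : (j <= i)%N -> fnorm X (s_ i \- s_ j) <= e_ j - e_ i.
  move=> /subnK <-; elim: (i - j)%N => [|p IH].
    rewrite add0n subrr; have -> : s_ j \- s_ j = (fun=> 0).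
      by apply/funext => v /=; rewrite subrr.
    by rewrite fnorm_zero.
  have [_ h1 h2 _ _] := step (p + j)%N.
  rewrite addSn; apply: le_trans (fnorm_dist_triangle (Xs _) (Xs (p + j)%N) (Xs _)) _.
  by lra.
have e_small (eps : R) : 0 < eps -> exists j, e_ j < eps.
  move=> eps0.
  have e_le j : e_ j <= j.+1%:R^-1.
    elim: j => [|j IH]; first by rewrite invr1 /e_.
    have [_ _ h2 _ _] := step j.
    apply: le_trans h2 _; apply: (@le_trans _ _ (j.+1%:R^-1 / 2)); first by rewrite ler_pM2r.
    rewrite -invfM lef_pV2 ?posrE ?mulr_gt0// -natrM ler_nat; lia.
  have [j _ Hj] := near_infty_natSinv_lt (PosNum eps0).
  by exists j; apply: le_lt_trans (e_le j) _; have := Hj j (leqnn j).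
(* The value at a vertex is final once the vertex enters some [F_ i]; it stays 0 if this never
   happens. *)
have stat v : exists c, exists i0, forall i, (i0 <= i)%N -> s_ i v = c.
  have [[i0 vi0]|H] := pselect (exists i, v \in F_ i); last first.
    exists 0, 0%N => i _; apply: (inv i).1; apply/negP => vi.
    by apply: H; exists i.
  exists (s_ i0 v), i0 => i /subnK <-.
  suff: v \in F_ (i - i0 + i0)%N /\ s_ (i - i0 + i0)%N v = s_ i0 v by case.
  elim: (i - i0)%N => // p [IH1 IH2]; rewrite addSn.
  have [/(_ v IH1)[h1 h2] _ _ _ _] := step (p + i0)%N.
  by split => //; rewrite -IH2.
have [f Hf] := choice stat.
have [|Xf Nf] := solid_stationary HX Xs _ e_small Hf.
  by move=> i j ij; apply: le_trans (dist _ _ ij) _; have := (inv i).2; lra.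
exists f; split=> //; split; first by move=> _ [n _ <-]; exact: carrier_iter.
move=> y Xy eps eps0.
(* Three errors below [eps / 4] add up: later increments, the approach to [y_ j], and the distance
   from [y_ j] to [y]. *)
have [|j [dj yj]] := ydense y (eps / 4) Xy; first lra.
exists (iter (n_ j) T f); split; first by exists (n_ j).
have [_ _ _ h1 h2] := step j.
have h3 : fnorm X (iter (n_ j) T f \- iter (n_ j) T (s_ j.+1)) <= d_ j.
  rewrite -iter_sub//; apply: le_trans (HD _ _ (carrier_sub Xf (Xs _))) _.
  by apply: le_trans h1; rewrite ler_wpM2l// ltW.
have Xyj : carrier X (y_ j) := supported_carrier (yt j).
have XTf := carrier_iter (n_ j) Xf.
have XTs := carrier_iter (n_ j) (Xs j.+1).
apply: le_lt_trans (fnorm_dist_triangle XTf XTs Xy) _.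
have := fnorm_dist_triangle XTs Xyj Xy; lra.
Qed.

(** The targets are finite combinations of unit vectors with coefficients in a countable dense set.
    Each is paired with every natural number, so that it recurs with arbitrarily small tolerance. *)
Lemma recurrent_hypercyclic : recurrent X T -> hypercyclic X T.
Proof.
move=> rec; have [Q [iota Hiota]] := absv_separable Hm.
pose y (l : seq (V * Q)) v := \sum_(p <- l) iota p.2 * delta K p.1 v.
(* Integers that encode no pair default to the zero target. *)
pose idx j : seq (V * Q) * nat := odflt ([::], 0%N) (unpickle j).
apply: (@recurrent_hypercyclic_targets (fun j => y (idx j).1)
  (fun j => map fst (idx j).1) (fun j => (idx j).2.+1%:R^-1)) => //.
- move=> j v vj; rewrite /y big1_seq// => p /andP[_ pj].
  rewrite /delta; case: eqP => [vp|]; last by rewrite mulr0.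
  by move: vj; rewrite vp map_f.
- move=> f eps Xf e0.
have [|s0 Hs0] := solid_tail HX (eps := eps / 2) Xf; first lra.
pose s := undup s0; pose S := \sum_(u <- s) m (mu u).
have S0 : 0 <= S by apply: sumr_ge0 => u _; exact: (absv_ge0 Hm).
pose d := eps / 2 / (1 + S).
have d0 : 0 < d by rewrite !divr_gt0//; lra.
have dS : d * S <= eps / 2.
  by rewrite /d mulrAC ler_pdivrMr; nra.
have /choice[q Hq] : forall u, exists q, m (iota q - f u) < d.
  by move=> u; exact: Hiota.
have [k _ Hk] := near_infty_natSinv_lt (PosNum e0).
exists (pickle ([seq (u, q u) | u <- s], k)).
rewrite /idx pickleK /=; split; first by have := Hk k (leqnn k).
pose f0 v := if v \in s0 then 0 else f v.
pose z v := \sum_(u <- s) (iota (q u) - f u) * delta K u v.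
have Xf0 : carrier X f0.
  have [] // := solid_dom HX (g := f0) Xf _ => v.
  by rewrite /f0; case: ifP => _; rewrite ?(absv0 Hm) ?(absv_ge0 Hm).
have [|Xz Nz] := solid_sum (r := s) (fun u => iota (q u) - f u) (g := delta K).
  by move=> u _; have [] := solid_delta HX u.
(* The error splits into the rounding of coefficients on [s] and the tail of [f] off [s]. *)
have -> : y [seq (u, q u) | u <- s] \- f = z \- f0.
  apply/funext => v; rewrite /= /y big_map /z /=.
  under [in RHS]eq_bigr do rewrite mulrBl.
  rewrite sumrB -addrA; congr (_ + _); rewrite -opprD; congr (- _).
  pose f1 v := if v \in s then f v else 0.
  have sf1 : supported s f1 by move=> w ws; rewrite /f1 (negbTE ws).
  have -> : \sum_(u <- s) f u * delta K u v = f1 v.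
    rewrite (supported_sum (undup_uniq _) sf1); apply: eq_big_seq => u us.
    by rewrite /f1 us.
  by rewrite /f1 /f0 mem_undup; case: ifP; rewrite ?addr0 ?add0r.
apply: le_lt_trans (ler_fnormB Xz Xf0) _.
have hz : fnorm X z <= d * S.
  apply: le_trans Nz _; rewrite /S mulr_sumr; apply: ler_sum => u _.
  have [Xu Nu] := solid_delta HX u.
  apply: ler_pM; [exact: (absv_ge0 Hm)|exact: fnorm_ge0|exact: ltW|exact: Nu].
move: Hs0; rewrite -/f0; lra.
Qed.

(** * From a dense orbit to recurrence *)

(** The orbit approaches [f] plus a small multiple [z] of a unit vector, where [z] differs from
    every early displacement [a n]; an approximation finer than the gap forces a time at least
    [N]. *)
Lemma dense_orbit_returns f N eps : carrier X f ->
  dense_in X [set iter n T f | n in [set: nat]] -> 0 < eps ->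
  exists2 n, (N <= n)%N & fnorm X (iter n T f \- f) < eps.
Proof.
move=> Xf [_ fdense] e0; case: V0 => v0.
have mu0 : 0 < m (mu v0) := absv_gt0 Hm (Hmu v0).
pose a n := iter n T f v0 - f v0.
have [c c0 Hc] : exists2 c, 0 < c & forall n,
    n \in [seq n <- iota 0 N | a n != 0] -> c <= m (a n).
  by apply: seq_lower_bound => n; rewrite mem_filter => /andP[/(absv_gt0 Hm)].
(* Below [c], a nonzero [z] differs from the nonzero [a n] by its size and from the others by being
   nonzero. The second bound keeps the perturbation below [eps / 2] in norm. *)
pose b := Num.min c (eps / 2 / m (mu v0)).
have b0 : 0 < b by rewrite lt_min c0 !divr_gt0.
have [k _ Hk] := near_infty_natSinv_lt (PosNum b0).
pose z : K := k.+1%:R^-1.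
have z0 : z != 0 by rewrite invr_eq0 pnatr_eq0.
have mz : m z < b.
  by rewrite /z (absvV Hm) ?pnatr_eq0// (absv_nat Hm); have := Hk k (leqnn k).
move: mz; rewrite lt_min ltr_pdivlMr// => /andP[mzc mze].
have [c' c'0 Hc'] : exists2 c', 0 < c' & forall n, n \in iota 0 N -> c' <= m (a n - z).
  apply: seq_lower_bound => n nN; apply: (absv_gt0 Hm); apply/eqP => anz.
  have anz' : a n = z by apply/eqP; rewrite -subr_eq0; apply/eqP.
  have := Hc n; rewrite mem_filter nN andbT anz' => /(_ z0); lra.
pose g := f \+ (fun v => z * delta K v0 v).
have [Xd Nd] := solid_delta HX v0.
have [Xzd Nzd] := solid_scale HX z Xd.
have [Xg _] := solid_add HX Xf Xzd.
have [|_ [[n _ <-] Hn]] := fdense g Xg (Num.min (eps / 2) (c' * m (mu v0))).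
  by rewrite lt_min; apply/andP; split; [lra|exact: mulr_gt0].
have XTf := carrier_iter n Xf.
move: Hn; rewrite lt_min => /andP[Hn1 Hn2].
exists n.
  rewrite leqNgt; apply/negP => nN.
  have := solid_coord HX v0 (carrier_sub XTf Xg).
  rewrite /= /g /delta /= eqxx mulr1 opprD addrA => h.
  have := le_lt_trans h Hn2; rewrite ltr_pM2r// ltNge Hc'//.
  by rewrite mem_iota add0n.
apply: le_lt_trans (fnorm_dist_triangle XTf Xg Xf) _.
have -> : g \- f = (fun v => z * delta K v0 v).
  by apply/funext => v; rewrite /g /= addrAC subrr add0r.
have : m z * fnorm X (delta K v0) <= m z * m (mu v0).
  by rewrite ler_wpM2l ?(absv_ge0 Hm).
lra.
Qed.

(** The n-th iterate inherits the returns of [f], because its displacement after p steps is the n-th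
    iterate of the displacement of [f]. *)
Lemma hypercyclic_recurrent : hypercyclic X T -> recurrent X T.
Proof.
move=> [f [Xf fdense]]; have [D D1 HD] := iter_bounded.
split; first by move=> g [].
move=> g Xg eps e0; have [_ /(_ g Xg eps e0)] := fdense.
move=> [_ [[n _ <-] Hn]]; exists (iter n T f); split=> //.
apply/recurrent_vectorP; split; first exact: carrier_iter.
move=> N e e_gt0; have Dn : 0 < D ^+ n by rewrite exprn_gt0//; lra.
have [|p Np Hp] := dense_orbit_returns N (eps := e / D ^+ n) Xf fdense.
  by rewrite divr_gt0.
exists p => //; rewrite -iterD addnC iterD -iter_sub//; last exact: carrier_iter.
apply: le_lt_trans (HD _ _ (carrier_sub (carrier_iter p Xf) Xf)) _.
by rewrite mulrC -ltr_pdivlMr.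
Qed.

End Operator.
End SolidTheory.

(** * The backward shift on c0 and ell^p *)

Section BackwardShift.
Variables (V : countType) (K : numFieldType) (E : rel V).

(** The partial sums are constant on the finite sets containing [u]. *)
Lemma sum_singleton (f : V -> K) (u : V) : (forall v, v != u -> f v = 0) ->
  sum (K := K) (R := K^o) f = f u.
Proof.
move=> fu; apply: (@cvg_lim K^o); 
  [exact: norm_hausdorff|exact: totally_filter|].
apply: cvg_near_cst; first exact: (@totally_filter V).
exists (finmap.fset1 u) => // A /= uA.
have {}uA : u \in finmap.enum_fset A by move: uA; rewrite finmap.fsub1set.
rewrite /partial_sum -(finmap.big_seq_fsetE _ _ xpredT)/= (bigD1_seq u)//= ?big1 ?addr0//.
exact: finmap.fset_uniq.
Qed.

Lemma backward_shift_delta (par : V -> V) (u : V) :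
  (forall u v, E u v = (u == par v)) ->
  backward_shift E (delta K u) = delta K (par u).
Proof.
move=> parE; apply/funext => v; rewrite /backward_shift (@sum_singleton _ u).
  rewrite /patch /delta eqxx; case: ifPn => [|].
    by rewrite inE /Chi /= parE => ->.
  by rewrite notin_setE /Chi /= parE => /negP/negbTE ->.
by move=> w wu; rewrite /patch /delta (negbTE wu); case: ifP.
Qed.

End BackwardShift.

(** * Solidity of the weighted sequence spaces *)

Section SequenceSpaces.
Variables (V : countType) (R : realType) (K : numFieldType) (m : K -> R).
Hypotheses (Hm : absolute_value m) (V0 : inhabited V).
Variable mu : V -> K.
Let a (f : V -> K) v := m (f v * mu v).

Let a_ge0 f v : 0 <= a f v. Proof. exact: absv_ge0. Qed.

Let a_le f g v : m (g v) <= m (f v) -> a g v <= a f v.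
Proof. by move=> gf; rewrite /a !absvM// ler_wpM2r// absv_ge0. Qed.

Let aD f g v : a (f \+ g) v <= a f v + a g v.
Proof. by rewrite /a mulrDl; exact: absvD. Qed.

Let aZ c f v : a (fun v => c * f v) v = m c * a f v.
Proof. by rewrite /a -mulrA absvM. Qed.

Let a_delta u v : a (delta K u) v = if v == u then m (mu u) else 0.
Proof.
rewrite /a /delta; case: eqP => [->|_]; first by rewrite mul1r.
by rewrite mul0r absv0.
Qed.

Let a_off (s : seq V) f v :
  a (fun v => if v \in s then 0 else f v) v = if v \in s then 0 else a f v.
Proof. by rewrite /a; case: ifP => // _; rewrite mul0r absv0. Qed.

Lemma stationary_on_seq (s_ : nat -> V -> K) (f : V -> K) (s : seq V) :
  (forall v, exists i0, forall i, (i0 <= i)%N -> s_ i v = f v) ->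
  exists i0, forall i, (i0 <= i)%N -> {in s, s_ i =1 f}.
Proof.
move=> H; elim: s => [|v s [i1 H1]]; first by exists 0%N.
have [i2 H2] := H v; exists (maxn i1 i2) => i.
rewrite geq_max => /andP[h1 h2] w; rewrite inE => /orP[/eqP ->|ws].
  exact: H2.
exact: H1.
Qed.

(** * The case of c0, with its supremum norm *)

Section C0.
Let X := c0 m mu.

Lemma c0P f : carrier X f <-> forall eps, 0 < eps ->
  exists s : seq V, forall v, v \notin s -> m (f v * mu v) < eps.
Proof.
split=> H eps e0; have [F] := H eps e0.
  move=> [/finite_seqP[s ->] Hs]; exists s => v vs; apply: Hs => /=.
  exact/negP.
move=> HF; exists [set` F]; split; first exact: finite_seq.
by move=> v /= /negP; exact: HF.
Qed.

Lemma c0_norm_le f C : (forall v, m (f v * mu v) <= C) -> fnorm X f <= C.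
Proof.
move=> H; apply: ge_sup; last by move=> _ [v _ <-].
by case: V0 => v; exists (m (f v * mu v)), v.
Qed.

Lemma c0_le_norm f v : carrier X f -> m (f v * mu v) <= fnorm X f.
Proof.
move=> /c0P Xf; apply: ub_le_sup; last by exists v.
(* Values are below 1 off a finite list and at most their sum on it, so the set has an upper
   bound. *)
have [s Hs] := Xf 1 ltr01; exists (1 + \sum_(u <- undup s) a f u).
move=> _ [w _ <-]; have [ws|/Hs ws] := boolP (w \in s); last first.
  by apply: le_trans (ltW ws) _; rewrite lerDl sumr_ge0.
rewrite (bigD1_seq w) ?mem_undup ?undup_uniq//= addrCA lerDl addr_ge0//.
exact: sumr_ge0.
Qed.

Lemma c0_solid : solid_fspace m mu X.
Proof.
have addc f g : carrier X f -> carrier X g ->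
    carrier X (f \+ g) /\ fnorm X (f \+ g) <= fnorm X f + fnorm X g.
  move=> Xf Xg; split.
    move/c0P: Xf => Xf; move/c0P: Xg => Xg; apply/c0P => eps e0.
    have e2 : 0 < eps / 2 by lra.
    have [s Hs] := Xf _ e2; have [t Ht] := Xg _ e2.
    exists (s ++ t) => v; rewrite mem_cat negb_or => /andP[/Hs h1 /Ht h2].
    by apply: le_lt_trans (aD f g v) _; rewrite /a; lra.
  apply: c0_norm_le => v; apply: le_trans (aD f g v) _.
  by apply: lerD; exact: c0_le_norm.
have domc f g : carrier X f -> (forall v, m (g v) <= m (f v)) ->
    carrier X g /\ fnorm X g <= fnorm X f.
  move=> Xf gf; split.
    move/c0P: Xf => Xf; apply/c0P => eps /Xf[s Hs]; exists s => v /Hs.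
    by apply: le_lt_trans; exact: a_le.
  by apply: c0_norm_le => v; apply: le_trans (a_le (gf v)) _; exact: c0_le_norm.
split=> //.
- move=> c f Xf; split.
    move/c0P: Xf => Xf; apply/c0P => eps e0.
    have mc : 0 < 1 + m c by have := absv_ge0 Hm c; lra.
    have [s Hs] := Xf _ (divr_gt0 e0 mc); exists s => v /Hs.
    rewrite -/(a (fun v => c * f v) v) aZ ltr_pdivlMr// => h.
    by apply: le_lt_trans h; rewrite mulrC ler_wpM2l//; lra.
  apply: c0_norm_le => v; rewrite -/(a (fun v => c * f v) v) aZ.
  by rewrite ler_wpM2l ?absv_ge0//; exact: c0_le_norm.
- by move=> f v Xf; rewrite -absvM//; exact: c0_le_norm.
- move=> u; split.
    apply/c0P => eps e0; exists [:: u] => v; rewrite inE => vu.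
    by rewrite -/(a (delta K u) v) a_delta (negbTE vu).
  apply: c0_norm_le => v; rewrite -/(a (delta K u) v) a_delta.
  by case: ifP => // _; exact: absv_ge0.
- move=> f eps /c0P Xf e0; have [|s Hs] := Xf (eps / 2); first lra.
  exists s; apply: (@le_lt_trans _ _ (eps / 2)); last lra.
  apply: c0_norm_le => v; rewrite -/(a (fun v => if v \in s then 0 else f v) v).
  rewrite a_off; case: ifPn => [_|/Hs /ltW//]; lra.
move=> s_ e f Xs dist e_small Hf.
(* At [v], [f] agrees with a late [s_ i], so the bound on [s_ i \- s_ j] passes to this
   coordinate. *)
have fs j v : m ((f \- s_ j) v * mu v) <= e j.
  have [i0 Hi] := Hf v; have h := dist (maxn i0 j) j (leq_maxr _ _).
  have [XN _] : carrier X (\- s_ j) /\ fnorm X (\- s_ j) <= fnorm X (s_ j).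
    by apply: domc => // w; rewrite absvN.
  have [Xd _] := addc _ _ (Xs (maxn i0 j)) XN.
  apply: le_trans h; rewrite /= -(Hi (maxn i0 j) (leq_maxl _ _)).
  exact: (c0_le_norm v Xd).
split; last by move=> j; exact: c0_norm_le (fs j).
apply/c0P => eps eps0; have [|j Hj] := e_small (eps / 2); first lra.
have [|s Hs] := proj1 (c0P _) (Xs j) (eps / 2); first lra.
exists s => v /Hs h; have := aD (f \- s_ j) (s_ j) v.
rewrite /a /= subrK => /le_lt_trans; apply.
by have := fs j v; rewrite /=; lra.
Qed.

End C0.

(** * The case of ell^p, through finite sums *)

Section Ellp.
Variable p : R.
Hypothesis p1 : 1 <= p.
Let X := ellp m mu p.
Let p0 : 0 < p. Proof. exact: lt_le_trans p1. Qed.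

Lemma powRVK (x : R) : 0 <= x -> (x `^ p^-1) `^ p = x.
Proof. by move=> x0; rewrite -powRrM mulVf ?gt_eqF// powRr1. Qed.

Lemma powRKV (x : R) : 0 <= x -> (x `^ p) `^ p^-1 = x.
Proof. by move=> x0; rewrite -powRrM mulfV ?gt_eqF// powRr1. Qed.

Lemma powRp_le (x y : R) : 0 <= x -> 0 <= y -> (x `^ p <= y `^ p) = (x <= y).
Proof.
move=> x0 y0; apply/idP/idP => xy; last first.
  by apply: ge0_ler_powR; rewrite ?nnegrE//; exact: ltW.
rewrite -(powRKV x0) -(powRKV y0).
by apply: ge0_ler_powR; rewrite ?nnegrE ?powR_ge0// invr_ge0 ltW.
Qed.

Lemma ellp_sum_leP f (c : R) : (ellp_sum m mu p f <= c%:E)%E <->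
  forall s, uniq s -> \sum_(v <- s) (m (f v * mu v)) `^ p <= c.
Proof.
split=> [H s us|H].
  rewrite -lee_fin -sumEFin fsbig_seq//; apply: le_trans H.
  by apply: ereal_sup_ubound; exists [set` s] => //; split=> //; exact: finite_seq.
apply: ge_ereal_sup => _ [A [finA _] <-].
by rewrite fsbig_finite// sumEFin lee_fin; apply: H; exact: finmap.fset_uniq.
Qed.

Lemma ellp_sum_ge0 f : (0 <= ellp_sum m mu p f)%E.
Proof. by apply: esum_ge0 => v _; rewrite lee_fin powR_ge0. Qed.

(** Reduces norm estimates to finite real sums, away from extended reals. *)
Lemma ellp_leP f C : 0 <= C -> (carrier X f /\ fnorm X f <= C) <->
  forall s, uniq s -> \sum_(v <- s) (m (f v * mu v)) `^ p <= C `^ p.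
Proof.
move=> C0; rewrite -ellp_sum_leP /X /=; have := ellp_sum_ge0 f.
case: (ellp_sum m mu p f) => [r|_|//] /=; last first.
  by rewrite ltxx; split => [[]//|]; rewrite leye_eq.
rewrite !lee_fin => r0; split => [[_ h]|h].
  by rewrite -(powRVK r0) powRp_le// powR_ge0.
split; first exact: ltry.
by rewrite -(powRKV C0); apply: ge0_ler_powR; rewrite ?nnegrE ?powR_ge0// invr_ge0 ltW.
Qed.

Lemma ellp_norm_ge0 f : 0 <= fnorm X f.
Proof. exact: powR_ge0. Qed.

Lemma ellp_sum_le_norm f s : carrier X f -> uniq s ->
  \sum_(v <- s) (m (f v * mu v)) `^ p <= fnorm X f `^ p.
Proof.
by move=> Xf; apply: (proj1 (ellp_leP f (ellp_norm_ge0 f))).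
Qed.

(* Convexity of [x `^ p] at the point [(x + y) / (A + B)], a barycentre of
   [x / A] and [y / B] with weights [A / (A + B)] and [B / (A + B)]. *)
Lemma powR_add_convex (x y A B : R) : 0 <= x -> 0 <= y -> 0 < A -> 0 < B ->
  (x + y) `^ p <= (A + B) `^ p *
    (A / (A + B) * (x / A) `^ p + B / (A + B) * (y / B) `^ p).
Proof.
move=> x0 y0 A0 B0; have AB0 : 0 < A + B by lra.
have t0 : 0 <= A / (A + B) by rewrite divr_ge0// ltW.
have t1 : A / (A + B) <= 1 by rewrite ler_pdivrMr//; lra.
have xA : 0 <= x / A by rewrite divr_ge0// ltW.
have yB : 0 <= y / B by rewrite divr_ge0// ltW.
have h : (A / (A + B) * (x / A) + (1 - A / (A + B)) * (y / B)) `^ p <=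
    A / (A + B) * (x / A) `^ p + (1 - A / (A + B)) * (y / B) `^ p.
  have := @convex_powR R p p1 (Itv01 t0 t1) (x / A) (y / B).
  rewrite !inE /= !in_itv /= !andbT => /(_ xA yB).
  by rewrite !convRE.
have B_AB : 1 - A / (A + B) = B / (A + B) by field; lra.
have mean : A / (A + B) * (x / A) + B / (A + B) * (y / B) = (x + y) / (A + B).
  by field; lra.
move: h; rewrite B_AB mean => h.
have -> : (x + y) `^ p = (A + B) `^ p * ((x + y) / (A + B)) `^ p.
  rewrite -powRM ?(ltW AB0)//; last by rewrite divr_ge0// ?addr_ge0// ltW.
  by congr (_ `^ _); field; lra.
by rewrite ler_wpM2l// powR_ge0.
Qed.

(** Minkowski's inequality. Bounds [A] and [B] strictly above the norms are positive even for zero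
    functions; summing the convexity inequality over the normalized functions gives the bound
    [A + B], and then [A] and [B] approach the norms. *)
Lemma ellp_add f g : carrier X f -> carrier X g ->
  carrier X (f \+ g) /\ fnorm X (f \+ g) <= fnorm X f + fnorm X g.
Proof.
move=> Xf Xg.
have key A B : fnorm X f < A -> fnorm X g < B ->
    carrier X (f \+ g) /\ fnorm X (f \+ g) <= A + B.
  move=> fA gB.
  have A0 : 0 < A := le_lt_trans (ellp_norm_ge0 f) fA.
  have B0 : 0 < B := le_lt_trans (ellp_norm_ge0 g) gB.
  have AB0 : 0 < A + B := addr_gt0 A0 B0.
  apply/ellp_leP; first exact: ltW.
  move=> s us.
  have normalized h C : carrier X h -> 0 < C -> fnorm X h < C ->
      \sum_(v <- s) (a h v / C) `^ p <= 1.
    move=> Xh C0 hC; have Cp : 0 < C `^ p by exact: powR_gt0.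
    rewrite -(ler_pM2l Cp) mulr1 mulr_sumr.
    have : \sum_(v <- s) a h v `^ p <= C `^ p.
      apply: le_trans (ellp_sum_le_norm Xh us) _.
      by rewrite powRp_le ?ellp_norm_ge0// ltW.
    apply: le_trans; rewrite le_eqVlt; apply/orP; left; apply/eqP.
    apply: eq_bigr => v _; rewrite -powRM ?(ltW C0) ?divr_ge0 ?a_ge0 ?(ltW C0)//.
    by rewrite mulrC divfK// gt_eqF.
  have hf := normalized _ _ Xf A0 fA; have hg := normalized _ _ Xg B0 gB.
  apply: (@le_trans _ _ (\sum_(v <- s) (A + B) `^ p *
    (A / (A + B) * (a f v / A) `^ p + B / (A + B) * (a g v / B) `^ p))).
    apply: ler_sum => v _; apply: le_trans (powR_add_convex (a_ge0 f v) (a_ge0 g v) A0 B0).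
    by rewrite powRp_le ?addr_ge0 ?a_ge0 ?absv_ge0//; exact: aD.
  rewrite -mulr_sumr -[leRHS]mulr1 ler_wpM2l ?powR_ge0//.
  rewrite big_split/= -!mulr_sumr.
  have -> : 1 = A / (A + B) * 1 + B / (A + B) * 1 :> R.
    by rewrite !mulr1 -mulrDl divff// gt_eqF.
  by apply: lerD; rewrite ler_wpM2l// divr_ge0// ltW.
split.
  by have [] // := key (fnorm X f + 1) (fnorm X g + 1) _ _; rewrite ltrDl.
apply/ler_addgt0Pr => e e0.
rewrite [e]splitr addrACA.
by have [] // := key (fnorm X f + e / 2) (fnorm X g + e / 2) _ _;
  rewrite ltrDl divr_gt0.
Qed.

Lemma ellp_solid : solid_fspace m mu X.
Proof.
have domc f g : carrier X f -> (forall v, m (g v) <= m (f v)) ->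
    carrier X g /\ fnorm X g <= fnorm X f.
  move=> Xf gf; apply/ellp_leP; first exact: ellp_norm_ge0.
  move=> s us; apply: le_trans (ellp_sum_le_norm Xf us).
  by apply: ler_sum => v _; rewrite powRp_le ?absv_ge0//; exact: a_le.
split=> //; first exact: ellp_add.
- move=> c f Xf; apply/ellp_leP.
    by rewrite mulr_ge0 ?ellp_norm_ge0 ?absv_ge0.
  move=> s us; rewrite powRM ?ellp_norm_ge0 ?absv_ge0//.
  have := ler_wpM2l (powR_ge0 (m c) p) (ellp_sum_le_norm Xf us).
  apply: le_trans; rewrite mulr_sumr.
  apply: ler_sum => v _; rewrite -powRM ?absv_ge0//.
  by rewrite -/(a (fun v => c * f v) v) aZ.
- move=> f v Xf; rewrite -absvM//; have := ellp_sum_le_norm Xf (s := [:: v]) isT.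
  by rewrite big_seq1 powRp_le//; [exact: absv_ge0|exact: ellp_norm_ge0].
- move=> u; apply/ellp_leP; first exact: absv_ge0.
  move=> s us; have au v : (m (delta K u v * mu v)) `^ p =
      if v == u then m (mu u) `^ p else 0.
    rewrite -/(a (delta K u) v) a_delta; case: ifP => // _.
    by rewrite powR0// gt_eqF.
  under eq_bigr do rewrite au.
  rewrite -big_mkcond; have [us'|us'] := boolP (u \in s).
    by rewrite big_mkcond (bigD1_seq u)//= eqxx big1 ?addr0// => v /negbTE ->.
  rewrite big1_seq ?powR_ge0// => v /andP[/eqP -> vs].
  by rewrite vs in us'.
- move=> f eps Xf e0; have e2 : 0 < eps / 2 by lra.
  have d0 : 0 < (eps / 2) `^ p by exact: powR_gt0.
  set r := fine (ellp_sum m mu p f).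
  have rE : ellp_sum m mu p f = r%:E.
    by rewrite fineK// ge0_fin_numE ?ellp_sum_ge0.
  have r_ub : forall s, uniq s -> \sum_(v <- s) a f v `^ p <= r.
    by apply/ellp_sum_leP; rewrite rE.
  (* Some finite sum comes this close to [r], or else a number smaller than [r] would bound all
     finite sums. *)
  have [s us hs] : exists2 s, uniq s & r - (eps / 2) `^ p < \sum_(v <- s) a f v `^ p.
    apply: contrapT => H; suff: (ellp_sum m mu p f <= (r - (eps / 2) `^ p)%:E)%E.
      by rewrite rE lee_fin; lra.
    apply/ellp_sum_leP => s us; rewrite leNgt; apply/negP => h.
    by apply: H; exists s.
  exists s; apply: (@le_lt_trans _ _ (eps / 2)); last lra.
  have [] // : carrier X (fun v => if v \in s then 0 else f v) /\
    fnorm X (fun v => if v \in s then 0 else f v) <= eps / 2.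
  apply/ellp_leP; first lra.
  (* [s] and [t'] are disjoint, so the sum over [t'] is at most what the sum over [s] leaves of
     [r]. *)
  move=> t ut; pose t' := [seq v <- t | v \notin s].
  have ust : uniq (s ++ t').
    rewrite cat_uniq us filter_uniq// andbT /=; apply/hasPn => v.
    by rewrite mem_filter => /andP[].
  have := r_ub _ ust; rewrite big_cat/= big_filter [X in _ + X]big_mkcond/= => h.
  have : \sum_(v <- t) (if v \notin s then a f v `^ p else 0) <= (eps / 2) `^ p.
    by lra.
  apply: le_trans; apply: ler_sum => v _.
  rewrite -/(a (fun v => if v \in s then 0 else f v) v) a_off.
  by case: ifP => _ //=; rewrite powR0// gt_eqF.
move=> s_ e f Xs dist e_small Hf.
have e_ge0 j : 0 <= e j by apply: le_trans (dist j j (leqnn j)); exact: ellp_norm_ge0.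
(* On a finite list, [f] equals a late [s_ i], so the bound holds for every finite sum and hence for
   the norm. *)
have fs j : carrier X (f \- s_ j) /\ fnorm X (f \- s_ j) <= e j.
  apply/ellp_leP => // s us; have [i0 Hi] := stationary_on_seq s Hf.
  have h := dist (maxn i0 j) j (leq_maxr _ _).
  have [XN _] : carrier X (\- s_ j) /\ fnorm X (\- s_ j) <= fnorm X (s_ j).
    by apply: domc => // v; rewrite absvN.
  have [Xd _] := ellp_add (Xs (maxn i0 j)) XN.
  have := proj1 (ellp_leP _ (e_ge0 j)) (conj Xd h) s us; apply: le_trans.
  rewrite le_eqVlt; apply/orP; left; apply/eqP; apply: eq_big_seq => v vs /=.
  by rewrite (Hi _ (leq_maxl _ _) v vs).
split; last by move=> j; have [] := fs j.
have -> : f = (f \- s_ 0%N) \+ s_ 0%N by apply/funext => v /=; rewrite subrK.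
by have [] := ellp_add (proj1 (fs 0%N)) (Xs 0%N).
Qed.

End Ellp.
End SequenceSpaces.

Theorem corollary5p2 (R : realType) (K : numFieldType) (modulus : K -> R)
    (HK : scalar_field modulus)
    (V : countType) (E : rel V) (Htree : directed_tree E) (Hun : unrooted E)
    (mu : V -> K) (Hmu : weight mu)
    (X : normed_fspace V K R)
    (HX : (exists p : R, 1 <= p /\ X = ellp modulus mu p) \/ X = c0 modulus mu)
    (Hdef : backward_shift_defined E X)
    (HB : bounded_operator X (backward_shift E)) :
  hypercyclic X (backward_shift E) <-> recurrent X (backward_shift E).
Proof.
have Hm := scalar_field_absolute_value HK.
have V0 := tree_nonempty Htree.
(* From here on [X] enters through solidity and the boundedness of the shift, which covers both
   kinds of spaces. *)
have SX : solid_fspace modulus mu X.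
  by case: HX => [[p [p1 ->]]| ->]; [exact: ellp_solid|exact: c0_solid].
have [par parE] := parent_exists Htree Hun.
have Tdelta u := backward_shift_delta K u parE.
split.
  exact: (hypercyclic_recurrent Hm SX Hmu V0 HB).
exact: (recurrent_hypercyclic Hm SX Hmu V0 HB Tdelta (iter_par_escapes Htree parE)).
Qed.
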